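(* Let $f\in\mathcal{F}_L(\mathbb{R}^N)$, let $\mathcal{D}\subseteq\mathcal{S}^{N-1}$ be a $\theta$-cover, let $x(0)\in\mathbb{R}^N$, and let $T\geq 1$ be an integer. i) Suppose $f(x(0))>f^\star$. The optimal value of the optimization problem $$\underset{\kappa,\gamma}{\text{minimize}}\;\; \epsilon(\kappa,\gamma)=\kappa+\frac{L}{2\cos(\theta)}\gamma\quad\text{subject to}\quad \frac{f(x(0))-f^\star}{\cos(\theta)\gamma\kappa}\leq T,\;\; \gamma,\kappa>0,$$ is $$\epsilon^\star=\frac{\sqrt{2L(f(x(0))-f^\star)}}{\cos(\theta)\sqrt{T}},$$ where the corresponding optimal $\gamma$ and $\kappa$ are $$\gamma^\star=\sqrt{\frac{2(f(x(0))-f^\star)}{LT}}\quad\text{and}\quad \kappa^\star=\frac{\sqrt{L(f(x(0))-f^\star)}}{\cos(\theta)\sqrt{2T}}.$$ ii) If the iterates $x(t)$ are generated by $x(t+1)=x(t)-\gamma d(t)$, $t=0,1,2,\ldots$, with constant step-size $\gamma=\gamma^\star$, where $\gamma^\star$ and $\epsilon^\star$ are given by the formulas in i) and $d(t)\in\mathcal{D}$ satisfies $\mathrm{ang}(\nabla f(x(t)),d(t))\leq\theta$ whenever $\nabla f(x(t))\neq0$ (and $d(t)\in\mathcal{D}$ is arbitrary otherwise), then $$\|\nabla f(x^\star(T))\|\leq\epsilon^\star,\qquad\text{where } x^\star(T)\in\underset{x\in\{x(t)\,:\,t=0,\ldots,T\}}{\mathrm{argmin}}\|\nabla f(x)\|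.$$
   Context: $N\geq 1$, $L>0$, $\|\cdot\|$ is the Euclidean norm and $\mathcal{S}^{N-1}$ is the unit sphere in $\mathbb{R}^N$. For nonzero $u,v\in\mathbb{R}^N$, $\mathrm{ang}(u,v)=\cos^{-1}\big(\langle u,v\rangle/(\|u\|\|v\|)\big)$. Class $\mathcal{F}_L(\mathbb{R}^N)$: the set of functions $f:\mathbb{R}^N\to\mathbb{R}$ that are convex and differentiable with $L$-Lipschitz continuous gradient and whose set of minimizers $\mathcal{X}^\star=\arg\min_{x\in\mathbb{R}^N} f(x)$ is nonempty and bounded; $f^\star=\min_{x\in\mathbb{R}^N}f(x)$. $\theta$-cover: a finite set $\mathcal{D}\subseteq\mathcal{S}^{N-1}$ is a $\theta$-cover if $\theta\in[0,\pi/2)$ and for all $g\in\mathcal{S}^{N-1}$ there is $d\in\mathcal{D}$ such that $\mathrm{ang}(g,d)\leq\theta$. *)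

(* Defs.v *)
(* R^N is represented by 'rV[R]_N, for an arbitrary R : realType. *)
From HB Require Import structures.
From mathcomp Require Import all_boot all_order all_algebra.
From mathcomp Require Import all_classical all_reals all_analysis.
Export numFieldNormedType.Exports.

Set Implicit Arguments.
Unset Strict Implicit.
Unset Printing Implicit Defensive.

Import Order.TTheory GRing.Theory Num.Theory.
Local Open Scope classical_set_scope.
Local Open Scope ring_scope.

Definition dotv (R : realType) (N : nat) (u v : 'rV[R]_N) : R :=
  \sum_(i < N) u 0 i * v 0 i.

(* The library norm `|u| on 'rV[R]_N is the sup norm, so the Euclidean norm has
   to be introduced separately. *)
Definition enorm (R : realType) (N : nat) (u : 'rV[R]_N) : R :=
  Num.sqrt (dotv u u).

Definition usphere (R : realType) (N : nat) : set 'rV[R]_N :=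
  [set u | enorm u = 1].

(* Meaningful for u != 0 and v != 0 only. *)
Definition ang (R : realType) (N : nat) (u v : 'rV[R]_N) : R :=
  acos (dotv u v / (enorm u * enorm v)).

(* The vector of partial derivatives; for f differentiable at x it represents
   the differential of f at x with respect to [dotv], see [diff_gradient]. *)
Definition gradient (R : realType) (N : nat) (f : 'rV[R]_N -> R)
    (x : 'rV[R]_N) : 'rV[R]_N :=
  \row_(i < N) 'D_('e_i) f x.

Lemma diff_gradient (R : realType) (N : nat) (f : 'rV[R]_N -> R)
    (x v : 'rV[R]_N) :
  differentiable f x -> 'd f x v = dotv (gradient f x) v.
Proof.
move=> df; rewrite [in LHS](row_sum_delta v) linear_sum /dotv.
by apply: eq_bigr => i _; rewrite mxE deriveE// linearZ mulrC.
Qed.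

Definition argmin_on (R : realType) (T : Type) (A : set T) (F : T -> R) :
    set T :=
  [set x | A x /\ forall y, A y -> F x <= F y].

(* Optimal value of the minimization of F over A: the infimum, which is the
   minimum as soon as it is attained, see [minvalE]. *)
Definition minval (R : realType) (T : Type) (A : set T) (F : T -> R) : R :=
  inf (F @` A).

Lemma minvalE (R : realType) (T : Type) (A : set T) (F : T -> R) (x : T) :
  argmin_on A F x -> minval A F = F x.
Proof.
move=> [Ax Fx]; apply/eqP; rewrite eq_le; apply/andP; split.
  by apply: ge_inf; [exists (F x) => _ [y Ay <-]; exact: Fx|exists x].
by apply: lb_le_inf; [exists (F x), x|move=> _ [y Ay <-]; exact: Fx].
Qed.

(* Lipschitz continuity and boundedness are with respect to the Euclidean
   norm. *)
Definition class_F (R : realType) (N : nat) (L : R) : set ('rV[R]_N -> R) :=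
  [set f | [/\ convex_function setT f,
               (forall x, differentiable f x),
               (forall x y,
                  enorm (gradient f x - gradient f y) <= L * enorm (x - y)),
               argmin_on setT f !=set0 &
               exists M : R, forall x, argmin_on setT f x -> enorm x <= M]].

Definition theta_cover (R : realType) (N : nat) (theta : R)
    (D : set 'rV[R]_N) : Prop :=
  [/\ finite_set D, D `<=` @usphere R N, 0 <= theta < pi / 2 &
      forall g, usphere g -> exists2 d, D d & ang g d <= theta].

(* Main.v *)
Require Import Defs.
From HB Require Import structures.
From mathcomp Require Import all_boot all_order all_algebra.
From mathcomp Require Import all_classical all_reals all_analysis.
From mathcomp Require Import ring lra.

(** The descent lemma for an L-Lipschitz gradient says that a step [- gamma d]
along a unit vector [d] changes [f] by at most
[- gamma <grad f, d> + L gamma^2 / 2].  As [d] makes an angle at most [theta]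
with the gradient, [<grad f, d>] is at least [cos theta * |grad f|], so a step
from a point where
[|grad f| > eps(kappa, gamma) = kappa + L gamma / (2 cos theta)] decreases [f]
by more than [cos theta * gamma * kappa].  If every iterate up to time [T] were
such a point, [f] would lose more than [T * cos theta * gamma * kappa] in [T]
steps; when this number is at least the initial gap [f x0 - fstar], that is
absurd.  Hence every feasible pair [(kappa, gamma)] gives the bound
[eps(kappa, gamma)] on the smallest gradient norm
([constant_step_gradient_bound]), and part i) selects the best such bound.

The feasibility constraint reads [b <= kappa * gamma], with
[b = (f x0 - fstar) / (T cos theta)], and the objective is
[kappa + a * gamma], with [a = L / (2 cos theta)].  By the inequality between
arithmetic and geometric means the minimum is [2 sqrt(a b)], attained only when
both terms equal [sqrt(a b)] ([argmin_hyperbola]).  The three closed formulas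
of the theorem are [sqrt(b / a)], [sqrt(a b)] and [2 sqrt(a b)]
([optimal_parameters_closed_form]).

In part ii) the point [x0] may already be a minimizer.  Then the step-size and
the bound are both 0, and the claim is that the gradient vanishes at a
minimizer, which also comes from the descent lemma ([sqr_gradient_le_gap]). *)

Set Implicit Arguments.
Unset Strict Implicit.
Unset Printing Implicit Defensive.

Import Order.TTheory GRing.Theory Num.Theory.
Local Open Scope classical_set_scope.
Local Open Scope ring_scope.

(** * Euclidean inner product and norm *)

Lemma dotvC (R : realType) (N : nat) (u v : 'rV[R]_N) : dotv u v = dotv v u.
Proof. by apply: eq_bigr => i _; rewrite mulrC. Qed.

Lemma dotvBl (R : realType) (N : nat) (u v w : 'rV[R]_N) :
  dotv (u - v) w = dotv u w - dotv v w.
Proof.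
by rewrite /dotv -sumrB; apply: eq_bigr => i _; rewrite !mxE mulrBl.
Qed.

Lemma dotvZl (R : realType) (N : nat) (a : R) (u v : 'rV[R]_N) :
  dotv (a *: u) v = a * dotv u v.
Proof.
by rewrite /dotv mulr_sumr; apply: eq_bigr => i _; rewrite !mxE mulrA.
Qed.

Lemma dotvBr (R : realType) (N : nat) (u v w : 'rV[R]_N) :
  dotv u (v - w) = dotv u v - dotv u w.
Proof. by rewrite !(dotvC u) dotvBl. Qed.

Lemma dotvZr (R : realType) (N : nat) (a : R) (u v : 'rV[R]_N) :
  dotv u (a *: v) = a * dotv u v.
Proof. by rewrite !(dotvC u) dotvZl. Qed.

Lemma dotvv_ge0 (R : realType) (N : nat) (u : 'rV[R]_N) : 0 <= dotv u u.
Proof. by apply: sumr_ge0 => i _; rewrite -expr2 sqr_ge0. Qed.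

Lemma dotvv_eq0 (R : realType) (N : nat) (u : 'rV[R]_N) :
  (dotv u u == 0) = (u == 0).
Proof.
apply/idP/eqP => [|->]; last by rewrite /dotv big1// => i _; rewrite mxE mul0r.
rewrite /dotv psumr_eq0 => [/allP u0|i _]; last by rewrite -expr2 sqr_ge0.
apply/rowP => i; rewrite mxE; apply/eqP.
by have := u0 i (mem_index_enum i); rewrite mulf_eq0 orbb.
Qed.

Lemma sqr_enorm (R : realType) (N : nat) (u : 'rV[R]_N) :
  enorm u ^+ 2 = dotv u u.
Proof. by rewrite sqr_sqrtr// dotvv_ge0. Qed.

Lemma enorm_ge0 (R : realType) (N : nat) (u : 'rV[R]_N) : 0 <= enorm u.
Proof. exact: sqrtr_ge0. Qed.

Lemma enorm_eq0 (R : realType) (N : nat) (u : 'rV[R]_N) :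
  (enorm u == 0) = (u == 0).
Proof. by rewrite -dotvv_eq0 -sqr_enorm sqrf_eq0. Qed.

Lemma enormZ (R : realType) (N : nat) (a : R) (u : 'rV[R]_N) :
  enorm (a *: u) = `|a| * enorm u.
Proof.
by rewrite /enorm dotvZl dotvZr mulrA -expr2 sqrtrM ?sqr_ge0// sqrtr_sqr.
Qed.

Lemma Cauchy_Schwarz_dotv (R : realType) (N : nat) (u v : 'rV[R]_N) :
  `|dotv u v| <= enorm u * enorm v.
Proof.
have [->|u0] := eqVneq u 0.
  by rewrite -(scale0r (0 : 'rV_N)) dotvZl mul0r normr0 mulr_ge0// enorm_ge0.
rewrite -[leRHS]ger0_norm ?mulr_ge0 ?enorm_ge0// -ler_sqr// ?nnegrE//.
rewrite !real_normK ?num_real// exprMn !sqr_enorm.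
have uu : 0 < dotv u u by rewrite lt_def dotvv_ge0 dotvv_eq0 u0.
(* Its square norm is [<u,u> * (<u,u> * <v,v> - <u,v>^2)]. *)
have := dotvv_ge0 (dotv u u *: v - dotv u v *: u).
rewrite !(dotvBl, dotvBr, dotvZl, dotvZr) (dotvC v u) => h.
rewrite -subr_ge0 -(pmulr_rge0 _ uu).
by move: h; congr (0 <= _); ring.
Qed.

(** * Descent along a direction *)

Lemma is_derive_along_line (R : realType) (N : nat) (f : 'rV[R]_N -> R)
    (x v : 'rV[R]_N) (s : R) :
  differentiable f (x + s *: v) ->
  is_derive s 1 (fun r : R => f (x + r *: v))
    (dotv (gradient f (x + s *: v)) v).
Proof.
move=> df.
(* The difference quotients of the restriction to the line are literally those
   of the directional derivative of [f] at [x + s *: v]. *)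
have quot :
    (fun h : R => h^-1 *: (f (x + (h *: 1 + s) *: v) - f (x + s *: v))) =
    (fun h => h^-1 *: (f (h *: v + (x + s *: v)) - f (x + s *: v))).
  apply/funext => h; congr (_ *: (f _ - _)).
  by rewrite [h *: 1]mulr1 scalerDl addrCA addrA.
split; first by rewrite /derivable /= quot; exact: diff_derivable.
rewrite /derive /= quot -diff_gradient//; exact: deriveE.
Qed.

(** Along the segment from [x] to [x + v], the difference between [f] and the
quadratic model on the right-hand side has derivative
[<grad f (x + s v) - grad f x, v> - s L |v|^2], which is nonpositive by
Cauchy-Schwarz and the Lipschitz condition. *)
Lemma descent_lemma (R : realType) (N : nat) (L : R) (f : 'rV[R]_N -> R)
    (x v : 'rV[R]_N) :
  (forall y, differentiable f y) ->
  (forall y z, enorm (gradient f y - gradient f z) <= L * enorm (y - z)) ->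
  f (x + v) <= f x + dotv (gradient f x) v + L / 2 * enorm v ^+ 2.
Proof.
move=> df lip.
pose h (s : R) := f (x + s *: v) -
   (s * dotv (gradient f x) v + s ^+ 2 * (L / 2 * enorm v ^+ 2)).
pose dh (s : R) := dotv (gradient f (x + s *: v) - gradient f x) v
   - s * (L * enorm v ^+ 2).
have hD (s : R) : is_derive s 1 h (dh s).
  have dl := is_derive_along_line (df (x + s *: v)).
  rewrite /h; apply: is_derive_eq; rewrite /dh dotvBl.
  by rewrite /GRing.scale /=; field.
have hC : {within `[0, 1], continuous h}.
  apply: derivable_within_continuous => r _.
  exact: (@ex_derive _ _ _ _ _ _ _ (hD r)).
have h10 : h 1 <= h 0.
  apply: (ler0_derive1_nincr (a := 0) (b := 1)) => // r.
  rewrite in_itv /= => /andP[r0 _].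
  rewrite derive1E (@derive_val _ _ _ _ _ _ _ (hD r)) subr_le0.
  apply: le_trans (ler_norm _) _; apply: le_trans (Cauchy_Schwarz_dotv _ _) _.
  have -> : r * (L * enorm v ^+ 2) = L * enorm (x + r *: v - x) * enorm v.
    by rewrite addrC addKr enormZ gtr0_norm//; ring.
  by apply: ler_wpM2r; rewrite ?enorm_ge0.
move: h10; rewrite /h scale1r scale0r addr0; lra.
Qed.

(** The step [- L^-1 *: grad f x], which minimizes the quadratic model of the
descent lemma, decreases [f] by at least [|grad f x|^2 / (2 L)], and this cannot
exceed [f x - m].  At a minimizer it shows that the gradient vanishes. *)
Lemma sqr_gradient_le_gap (R : realType) (N : nat) (L m : R)
    (f : 'rV[R]_N -> R) (x : 'rV[R]_N) :
  0 < L ->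
  (forall y, differentiable f y) ->
  (forall y z, enorm (gradient f y - gradient f z) <= L * enorm (y - z)) ->
  (forall y, m <= f y) ->
  enorm (gradient f x) ^+ 2 <= 2 * L * (f x - m).
Proof.
move=> L0 df lip mf; set g := gradient f x.
have := descent_lemma x (- L^-1 *: g) df lip.
rewrite -/g dotvZr -sqr_enorm enormZ normrN exprMn real_normK ?num_real//.
set e := enorm g ^+ 2 => h.
have {h} := le_trans (mf _) h.
have -> : f x + - L^-1 * e + L / 2 * (L^-1 ^+ 2 * e) = f x - e / (2 * L).
  by field; exact: lt0r_neq0.
by rewrite lerBrDr -lerBrDl ler_pdivrMr ?mulr_gt0// mulrC.
Qed.

(** Cauchy-Schwarz puts the cosine quotient between -1 and 1, where [cos] inverts
[acos]; the claim is then that [cos] decreases between 0 and [pi]. *)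
Lemma dotv_ge_of_ang (R : realType) (N : nat) (theta : R) (g d : 'rV[R]_N) :
  0 <= theta <= pi -> g != 0 -> enorm d = 1 -> ang g d <= theta ->
  cos theta * enorm g <= dotv g d.
Proof.
move=> thetapi g0 d1; rewrite /ang d1 mulr1.
have g_gt0 : 0 < enorm g by rewrite lt_def enorm_ge0 enorm_eq0 g0.
set q := dotv g d / enorm g => qtheta.
have q11 : -1 <= q <= 1.
  rewrite -ler_norml normrM normfV (gtr0_norm g_gt0) ler_pdivrMr// mul1r.
  by have := Cauchy_Schwarz_dotv g d; rewrite d1 mulr1.
rewrite -ler_pdivlMr// -/q -[leRHS]acosK ?in_itv//=.
rewrite le_eqVlt; have [acos0pi _] := acos_def q11.
move: qtheta; rewrite le_eqVlt => /orP[/eqP->|]; first by rewrite eqxx.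
by rewrite ltr_cos ?in_itv//= => ->; rewrite orbT.
Qed.

(** Here [c] is a lower bound on the cosine of the angles between gradients and
directions.  Were [e] larger than the claimed bound, each of the first [T] steps
would lose more than [c * gamma * kappa], and [f] would fall below its lower
bound [m]. *)
Lemma constant_step_gradient_bound (R : realType) (N : nat)
    (L m c kappa gamma e : R) (f : 'rV[R]_N -> R) (x d : nat -> 'rV[R]_N)
    (T : nat) :
  0 < c -> 0 < gamma -> (0 < T)%N -> 0 <= kappa -> 0 <= L ->
  (forall y, differentiable f y) ->
  (forall y z, enorm (gradient f y - gradient f z) <= L * enorm (y - z)) ->
  (forall y, m <= f y) ->
  (forall t, x t.+1 = x t - gamma *: d t) ->
  (forall t, enorm (d t) = 1) ->
  (forall t, gradient f (x t) != 0 ->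
     c * enorm (gradient f (x t)) <= dotv (gradient f (x t)) (d t)) ->
  f (x 0%N) - m <= T%:R * (c * gamma * kappa) ->
  (forall t, (t <= T)%N -> e <= enorm (gradient f (x t))) ->
  e <= kappa + L / (2 * c) * gamma.
Proof.
move=> c0 gamma0 T0 kappa0 L0 df lip mf xS d1 xd budget e_le.
rewrite leNgt; apply/negP => e_gt.
have decrease t : (t <= T)%N -> f (x t.+1) < f (x t) - c * gamma * kappa.
  move=> /e_le e_le_t; have grad_gt := lt_le_trans e_gt e_le_t.
  have grad0 : gradient f (x t) != 0.
    rewrite -enorm_eq0 gt_eqF//; apply: le_lt_trans grad_gt.
    by rewrite addr_ge0// mulr_ge0 ?(ltW gamma0)// divr_ge0// mulr_ge0// ltW.
  rewrite xS -scaleNr; apply: le_lt_trans (descent_lemma _ _ df lip) _.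
  rewrite enormZ d1 mulr1 normrN (gtr0_norm gamma0) dotvZr.
  have := xd t grad0; rewrite -(ler_pM2l gamma0) => slope.
  have : c * gamma * (kappa + L / (2 * c) * gamma) <
         c * gamma * enorm (gradient f (x t)) by rewrite ltr_pM2l ?mulr_gt0.
  have -> : c * gamma * (kappa + L / (2 * c) * gamma) =
      c * gamma * kappa + L / 2 * gamma ^+ 2 by field; exact: lt0r_neq0.
  lra.
have total n : (n < T)%N ->
    f (x n.+1) < f (x 0%N) - n.+1%:R * (c * gamma * kappa).
  elim: n => [|n IH] nT; first by rewrite mul1r; exact: decrease.
  apply: lt_trans (decrease _ (ltnW nT)) _.
  by rewrite -[n.+2]addn1 natrD mulrDl mul1r opprD addrA ltrD2r IH// ltnW.
(* The bound on the decrease is strict because at least one step is made. *)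
have := total T.-1; rewrite prednK// => /(_ (leqnn _)).
have := mf (x T); lra.
Qed.

(** * Minimizing a linear form on a hyperbolic region *)

Lemma sqrt_mul_scale (R : realType) (a c : R) :
  0 < a -> Num.sqrt (a * c) = a * Num.sqrt (c / a).
Proof.
move=> a0; have aE : a = Num.sqrt (a ^+ 2) by rewrite sqrtr_sqr gtr0_norm.
rewrite [X in _ = X * _]aE -sqrtrM ?sqr_ge0//.
by congr Num.sqrt; field; exact: lt0r_neq0.
Qed.

(** From [(x + a y)^2 = (x - a y)^2 + 4 a x y] and the constraint, the square of
the objective is at least [4 a c]; in case of equality [x = a y] and [x y = c],
which determines the point. *)
Lemma argmin_hyperbola (R : realType) (a c : R) : 0 < a -> 0 < c ->
  argmin_on [set p : R * R | [/\ c <= p.1 * p.2, 0 < p.2 & 0 < p.1]]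
    (fun p => p.1 + a * p.2) = [set (Num.sqrt (a * c), Num.sqrt (c / a))].
Proof.
move=> a0 c0; set k := Num.sqrt (a * c); set g := Num.sqrt (c / a).
have k0 : 0 < k by rewrite sqrtr_gt0 mulr_gt0.
have g0 : 0 < g by rewrite sqrtr_gt0 divr_gt0.
have kE : k = a * g by exact: sqrt_mul_scale.
have kgE : k * g = c.
  rewrite kE -mulrA -expr2 sqr_sqrtr ?divr_ge0 ?ltW//; field; exact: lt0r_neq0.
have amgm x y : c <= x * y ->
    4 * (a * c) <= (x + a * y) ^+ 2 - (x - a * y) ^+ 2.
  move=> cxy; have -> : (x + a * y) ^+ 2 - (x - a * y) ^+ 2 = 4 * (a * (x * y)).
    by ring.
  by rewrite ler_pM2l// ler_pM2l.
have sqk : k ^+ 2 = a * c by rewrite sqr_sqrtr// mulr_ge0 ?ltW.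
have kkE : (k + k) ^+ 2 = 4 * (a * c) by rewrite -sqk; ring.
have feas : [set p : R * R | [/\ c <= p.1 * p.2, 0 < p.2 & 0 < p.1]] (k, g).
  by split; rewrite //= kgE.
apply/seteqP; split => [[x y] /= [[cxy y0 x0] /(_ _ feas)]|_ ->] /=.
  rewrite -kE => opt; have /= := amgm _ _ cxy.
  have sum0 : 0 < x + a * y by rewrite addr_gt0// mulr_gt0.
  have : (x + a * y) ^+ 2 <= (k + k) ^+ 2 
    by rewrite ler_sqr// nnegrE ltW// addr_gt0.
  rewrite kkE => up lo; have sq0 : (x - a * y) ^+ 2 <= 0 by lra.
  have /eqP : (x - a * y) ^+ 2 = 0 by apply/eqP; rewrite eq_le sq0 sqr_ge0.
  rewrite sqrf_eq0 subr_eq0 => /eqP xE.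
  have xk : x = k.
    apply/eqP; rewrite eq_le; apply/andP; split; first by lra.
    rewrite -ler_sqr ?nnegrE ?(ltW k0) ?(ltW x0)// sqk.
    have -> : x ^+ 2 = a * (x * y) by rewrite expr2 {2}xE mulrCA.
    by rewrite ler_pM2l.
  by rewrite xk; congr (_, _); apply: (mulfI (lt0r_neq0 a0)); rewrite -xE -kE.
split=> // -[x y] /= [cxy y0 x0]; rewrite -kE.
have sum0 : 0 < x + a * y by rewrite addr_gt0// mulr_gt0.
rewrite -ler_sqr ?nnegrE ?(ltW sum0) ?(ltW (addr_gt0 k0 k0))//.
rewrite kkE; have /= := amgm _ _ cxy; have := sqr_ge0 (x - a * y); lra.
Qed.

(** Identifies the formulas for the optimal step-size, the optimal slack and the
optimal bound with the solution given by [argmin_hyperbola], for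
[c = cos theta] and [n = T]. *)
Lemma optimal_parameters_closed_form (R : realType) (L c n gap : R) :
  0 < L -> 0 < c -> 0 < n -> 0 < gap ->
  let a := L / (2 * c) in let b := gap / (n * c) in
  [/\ Num.sqrt (2 * gap / (L * n)) = Num.sqrt (b / a),
      Num.sqrt (L * gap) / (c * Num.sqrt (2 * n)) = Num.sqrt (a * b) &
      Num.sqrt (2 * L * gap) / (c * Num.sqrt n) = 2 * Num.sqrt (a * b)].
Proof.
move=> L0 c0 n0 gap0 a b.
have [L1 c1 n1] : [/\ L != 0, c != 0 & n != 0] by split; exact: lt0r_neq0.
have fold_sqrt u v : 0 < u -> 0 < v ->
    Num.sqrt u / (c * Num.sqrt v) = Num.sqrt (u / (c ^+ 2 * v)).
  move=> u0 v0; have v1 : 0 <= c ^+ 2 * v by rewrite mulr_ge0 ?sqr_ge0// ltW.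
  rewrite sqrtrM ?(ltW u0)// sqrtrV//.
  by rewrite sqrtrM ?sqr_ge0// sqrtr_sqr gtr0_norm.
split.
- by congr Num.sqrt; rewrite /a /b; field; rewrite L1 c1 n1.
- rewrite fold_sqrt ?mulr_gt0//; congr Num.sqrt; rewrite /a /b; field.
  by rewrite c1 n1.
- rewrite fold_sqrt ?mulr_gt0//.
  have two : 2 = Num.sqrt (2 ^+ 2) :> R by rewrite sqrtr_sqr gtr0_norm.
  rewrite [X in _ = X * _]two -sqrtrM ?sqr_ge0//; congr Num.sqrt.
  by rewrite /a /b; field; rewrite c1 n1.
Qed.

(** * The optimal constant step-size *)

Theorem corollary1 (R : realType) (N : nat) (hN : (1 <= N)%N)
    (L : R) (hL : 0 < L)
    (f : 'rV[R]_N -> R) (hf : class_F L f)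
    (theta : R) (D : set 'rV[R]_N) (hD : theta_cover theta D)
    (x0 : 'rV[R]_N) (T : nat) (hT : (1 <= T)%N) :
  let fstar := minval setT f in
  let eps_star :=
    Num.sqrt (2 * L * (f x0 - fstar)) / (cos theta * Num.sqrt T%:R) in
  let gamma_star := Num.sqrt (2 * (f x0 - fstar) / (L * T%:R)) in
  let kappa_star :=
    Num.sqrt (L * (f x0 - fstar)) / (cos theta * Num.sqrt (2 * T%:R)) in
  (fstar < f x0 ->
   let eps (p : R * R) :=
     let: (kappa, gamma) := p in kappa + L / (2 * cos theta) * gamma in
   let feasible : set (R * R) :=
     [set p | let: (kappa, gamma) := p in
        [/\ (f x0 - fstar) / (cos theta * gamma * kappa) <= T%:R,
            0 < gamma & 0 < kappa]] in
   minval feasible eps = eps_star /\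
   argmin_on feasible eps = [set (kappa_star, gamma_star)]) /\
  (forall x d : nat -> 'rV[R]_N,
     x 0%N = x0 ->
     (forall t, x t.+1 = x t - gamma_star *: d t) ->
     (forall t, D (d t)) ->
     (forall t, gradient f (x t) != 0 ->
        ang (gradient f (x t)) (d t) <= theta) ->
     forall xs : 'rV[R]_N,
       argmin_on [set x t | t in [set t | (t <= T)%N]]
         (fun y => enorm (gradient f y)) xs ->
       enorm (gradient f xs) <= eps_star).
Proof.
move=> fstar eps_star gamma_star kappa_star.
have [df lip [xm xm_min]] : [/\ forall x, differentiable f x,
    forall x y, enorm (gradient f x - gradient f y) <= L * enorm (x - y) &
    argmin_on setT f !=set0] by case: hf.
have [D1 /andP[theta0 theta_lt]] : D `<=` @usphere R N /\ 0 <= theta < pi / 2.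
  by case: hD.
have fstar_le y : fstar <= f y.
  by rewrite /fstar (minvalE xm_min); apply: xm_min.2.
have c0 : 0 < cos theta.
  by apply: cos_gt0_pihalf; rewrite theta_lt andbT; have := pi_gt0 R; lra.
have n0 : 0 < T%:R :> R by rewrite ltr0n.
set a := L / (2 * cos theta); have a0 : 0 < a by rewrite divr_gt0// mulr_gt0.
pose b := (f x0 - fstar) / (T%:R * cos theta).
have opt : fstar < f x0 -> [/\ 0 < b, gamma_star = Num.sqrt (b / a),
    kappa_star = Num.sqrt (a * b) & eps_star = 2 * Num.sqrt (a * b)].
  rewrite -subr_gt0 => gap0.
  have [] := optimal_parameters_closed_form hL c0 n0 gap0.
  by split=> //; rewrite divr_gt0// mulr_gt0.
split.
  move=> gap eps feasible; have [b0 gE kE eE] := opt gap.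
  have epsE : eps = (fun p => p.1 + a * p.2) by apply/funext => -[].
  have feasE : feasible =
      [set p : R * R | [/\ b <= p.1 * p.2, 0 < p.2 & 0 < p.1]].
    have budgetE kappa gamma : 0 < gamma -> 0 < kappa ->
        ((f x0 - fstar) / (cos theta * gamma * kappa) <= T%:R) =
        (b <= kappa * gamma).
      move=> gamma0 kappa0; rewrite /b !ler_pdivrMr ?mulr_gt0//.
      by congr (_ <= _); ring.
    apply/seteqP; split=> -[kappa gamma] /= [le_T gamma0 kappa0].
      by split; rewrite -?budgetE.
    by split; rewrite ?budgetE.
  have argE : argmin_on feasible eps = [set (kappa_star, gamma_star)].
    by rewrite feasE epsE argmin_hyperbola// kE gE.
  split=> //; rewrite (@minvalE _ _ _ _ (kappa_star, gamma_star)) ?argE//.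
  rewrite epsE /= eE kE gE (sqrt_mul_scale _ a0); ring.
move=> x d x_0 xS Dd xang xs [[t tT <-] xs_min].
have d1 s : enorm (d s) = 1 by exact: D1.
have : fstar <= f x0 by []; rewrite le_eqVlt => /orP[/eqP gap|gap].
  (* Here [x0] is a minimizer, and so a stationary point. *)
  have g0 : enorm (gradient f x0) = 0.
    have := sqr_gradient_le_gap x0 hL df lip fstar_le.
    rewrite gap subrr mulr0 => g_le0; apply/eqP; rewrite -sqrf_eq0.
    by rewrite eq_le g_le0 sqr_ge0.
  apply: le_trans (xs_min x0 _) _; first by exists 0%N.
  by rewrite g0 divr_ge0 ?sqrtr_ge0// mulr_ge0 ?sqrtr_ge0// ltW.
have [b0 gE kE eE] := opt gap.
have -> : eps_star = kappa_star + a * gamma_star.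
  by rewrite eE kE gE (sqrt_mul_scale _ a0); ring.
apply: (@constant_step_gradient_bound _ _ L fstar (cos theta) kappa_star
  gamma_star _ f x d T) => //.
- by rewrite gE sqrtr_gt0 divr_gt0.
- by rewrite kE sqrtr_ge0.
- exact: ltW.
- move=> s gs; apply: dotv_ge_of_ang (xang s gs) => //.
  by rewrite theta0 /=; have := pi_gt0 R; lra.
- rewrite x_0 gE kE (sqrt_mul_scale _ a0).
  have : Num.sqrt (b / a) ^+ 2 = b / a by rewrite sqr_sqrtr// ltW// divr_gt0.
  set r := Num.sqrt _ => r2.
  have -> : T%:R * (cos theta * r * (a * r)) = T%:R * cos theta * a * r ^+ 2.
    by ring.
  rewrite r2 [leRHS](_ : _ = f x0 - fstar)// /b; field.
  by rewrite !lt0r_neq0.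
- by move=> s sT; apply: xs_min; exists s.
Qed.
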